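(* Let $X$ be a coarse space. For coarse rays $\alpha,\alpha':\mathbb{R}_{\ge0}\to X$ write $\alpha\sim\alpha'$ if and only if there exists a coarse $1$-path from $\alpha$ to $\alpha'$. Then $\sim$ is an equivalence relation on the set of coarse rays in $X$. Further, the set of equivalence classes of $\sim$ is equivalent to $\pi_0^{\mathrm{Crs}}(X)$, i.e. the two quotients of the set of coarse rays in $X$ coincide.
   Context: A coarse structure on a set $X$ is a collection $\mathcal{C}_X$ of subsets of $X\times X$, called controlled sets, containing the diagonal $\Delta_X$ and closed under subsets, finite unions, inverses $U^{-1}=\{(x,x'):(x',x)\in U\}$ and composites $U\circ V=\{(x,x'):\exists x'',\ (x,x'')\in U,\ (x'',x')\in V\}$. A coarse space is a set with a coarse structure. $B\subseteq X$ is bounded if $B\times B\in\mathcal{C}_X$. A map $f:X\to Y$ of coarse spaces is controlled if $(f\times f)(E)\in\mathcal{C}_Y$ for all $E\in\mathcal{C}_X$, proper if preimages of bounded sets are bounded, and coarse if both. A metric space carries the metric coarse structure, in which $U\subseteq X\times X$ is controlled iff $\sup_{(x,x')\in U}d(x,x')<\infty$. The product coarse structure on $X\times Y$: $E$ is controlled iff its images in $X\times X$ and $Y\times Y$ are controlled. Subspaces carry the restricted coarse structure. For a coarse map $q:X\to\mathbb{R}_{\ge0}$, the $q$-cylinder is $I_qX=\{(x,t)\in X\times\mathbb{R}_{\ge0}: t\le q(x)\}$ with the coarse subspace structure of the product. Coarse maps $f,g:X\to Y$ are coarse homotopic if there are coarse maps $q:X\to\mathbb{R}_{\ge0}$ and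 $H:I_qX\to Y$ with $H(x,0)=f(x)$ and $H(x,q(x))=g(x)$ for all $x$. Coarse homotopy is (known to be) an equivalence relation. A coarse ray in $X$ is a coarse map $\mathbb{R}_{\ge0}\to X$. $\pi_0^{\mathrm{Crs}}(X)$ is the set of coarse homotopy classes of coarse rays in $X$. $c_1([0,1])=\{(ht,h)\in\mathbb{R}^2: h\ge1,\ t\in[0,1]\}$ with the Euclidean subspace metric. A coarse $1$-path from $\alpha$ to $\alpha'$ is a coarse map $\varphi:c_1([0,1])\to X$ with $\varphi(0,h)=\alpha(h)$ and $\varphi(h,h)=\alpha'(h)$ for all $h\ge1$. *)

(* Defs.v *)
From HB Require Import structures.
From Stdlib Require Export RelationClasses.
From mathcomp Require Export all_boot all_order all_algebra.
From mathcomp Require Export all_classical all_reals topology normedtype.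
From mathcomp Require Import ring lra.
Set Implicit Arguments.
Unset Strict Implicit.
Unset Printing Implicit Defensive.
Import Order.TTheory GRing.Theory Num.Theory.
Import numFieldNormedType.Exports.
Local Open Scope classical_set_scope.
Local Open Scope ring_scope.

(* The empty union is covered by [controlled_sub], since [set0 `<=` diagonal].
   The composite of U and V is written [V \; U] in [relation_scope]: it is
   [set xy | exists2 z, U (xy.1, z) & V (z, xy.2)]. *)
HB.mixin Record isCoarse (X : Type) := {
  controlled : set (set (X * X)) ;
  controlled_diag : controlled diagonal ;
  controlled_sub : forall U V, U `<=` V -> controlled V -> controlled U ;
  controlledU : forall U V, controlled U -> controlled V ->
    controlled (U `|` V) ;
  controlledV : forall U, controlled U -> controlled (U^-1)%relation ;
  controlled_comp : forall U V, controlled U -> controlled V ->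
    controlled (V \; U)%relation
}.

#[short(type="coarseType")]
HB.structure Definition Coarse := { X of isCoarse X }.

Definition sq (X Y : Type) (f : X -> Y) (p : X * X) : Y * Y := (f p.1, f p.2).

Section coarse_maps.
Context {X Y : coarseType}.

Definition coarsely_bounded (Z : coarseType) (B : set Z) : Prop :=
  controlled (B `*` B).

Definition controlled_map (f : X -> Y) : Prop :=
  forall E : set (X * X), controlled E -> controlled (sq f @` E).

Definition proper_map (f : X -> Y) : Prop :=
  forall B : set Y, coarsely_bounded B -> coarsely_bounded (f @^-1` B).

Definition coarse_map (f : X -> Y) : Prop := controlled_map f /\ proper_map f.

End coarse_maps.

Section metric_coarse.
Context {R : realType} (M : metricType R).

Definition metric_controlled : set (set (M * M)) :=
  [set U | has_ubound [set mdist p.1 p.2 | p in U]].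

Lemma metric_controlled_diag : metric_controlled diagonal.
Proof.
by exists 0 => _ [[x y]] /= /diagonalP -> <-; rewrite mdistxx.
Qed.

Lemma metric_controlled_sub U V :
  U `<=` V -> metric_controlled V -> metric_controlled U.
Proof.
by move=> UV [b Vb]; exists b => _ [p Up <-]; apply: Vb; exists p => //; exact: UV.
Qed.

Lemma metric_controlledU U V : metric_controlled U -> metric_controlled V ->
  metric_controlled (U `|` V).
Proof.
move=> [b Ub] [c Vc]; exists (Num.max b c) => _ [p Up <-].
rewrite le_max; apply/orP; case: Up => Up; [left; apply: Ub|right; apply: Vc].
all: by exists p.
Qed.

Lemma metric_controlledV U : metric_controlled U -> metric_controlled (U^-1)%relation.
Proof.
by move=> [b Ub]; exists b => _ [[x y] Uyx <-]; rewrite metric_sym; apply: Ub;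
  exists (y, x).
Qed.

Lemma metric_controlled_comp U V : metric_controlled U ->
  metric_controlled V -> metric_controlled (V \; U)%relation.
Proof.
move=> [b Ub] [c Vc]; exists (b + c) => _ [[x y] [z /= Uxz Vzy] <-] /=.
apply: le_trans (metric_triangle x z y) _.
by apply: lerD; [apply: Ub; exists (x, z)|apply: Vc; exists (z, y)].
Qed.

End metric_coarse.

HB.instance Definition _ (R : realType) := isCoarse.Build R
  (@metric_controlled_diag R R^o) (@metric_controlled_sub R R^o)
  (@metric_controlledU R R^o) (@metric_controlledV R R^o)
  (@metric_controlled_comp R R^o).

(* An alias of [R * R]: the library's distance on [R * R] is the sup distance. *)
Definition euclidean_plane (R : realType) : Type := (R * R)%type.

Section euclidean_plane.
Context {R : realType}.
Local Notation E2 := (euclidean_plane R).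

HB.instance Definition _ := Choice.copy E2 (R * R)%type.

Definition euclidean_dist (p q : E2) : R :=
  Num.sqrt ((p.1 - q.1) ^+ 2 + (p.2 - q.2) ^+ 2).

Lemma euclidean_distxx p : euclidean_dist p p = 0.
Proof. by rewrite /euclidean_dist !subrr expr0n addr0 sqrtr0. Qed.

Lemma euclidean_dist_positivity p q : euclidean_dist p q = 0 -> p = q.
Proof.
case: p q => [a b] [c d] /eqP; rewrite sqrtr_eq0 /= => h.
have ha : (a - c) ^+ 2 = 0 by have := sqr_ge0 (a - c); have := sqr_ge0 (b - d); lra.
have hb : (b - d) ^+ 2 = 0 by have := sqr_ge0 (a - c); have := sqr_ge0 (b - d); lra.
by congr pair; apply/eqP; rewrite -subr_eq0 -sqrf_eq0; apply/eqP.
Qed.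

Lemma euclidean_dist_sym p q : euclidean_dist p q = euclidean_dist q p.
Proof. by rewrite /euclidean_dist; congr Num.sqrt; ring. Qed.

Lemma euclidean_dist_triangle q p r :
  euclidean_dist p r <= euclidean_dist p q + euclidean_dist q r.
Proof.
rewrite /euclidean_dist; set a := p.1 - q.1; set b := p.2 - q.2.
set c := q.1 - r.1; set d := q.2 - r.2.
have -> : p.1 - r.1 = a + c by rewrite /a /c; ring.
have -> : p.2 - r.2 = b + d by rewrite /b /d; ring.
set s := Num.sqrt (a ^+ 2 + _); set t := Num.sqrt (c ^+ 2 + _).
have s2 : s ^+ 2 = a ^+ 2 + b ^+ 2 by rewrite sqr_sqrtr// addr_ge0// sqr_ge0.
have t2 : t ^+ 2 = c ^+ 2 + d ^+ 2 by rewrite sqr_sqrtr// addr_ge0// sqr_ge0.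
have s0 : 0 <= s by exact: sqrtr_ge0.
have t0 : 0 <= t by exact: sqrtr_ge0.
rewrite -[leRHS]ger0_norm ?addr_ge0// -sqrtr_sqr ler_wsqrtr//.
suff : a * c + b * d <= s * t by nra.
apply: le_trans (ler_norm _) _.
rewrite -[leRHS]ger0_norm ?mulr_ge0// -ler_sqr ?nnegrE// !real_normK ?num_real//.
rewrite exprMn s2 t2; have := sqr_ge0 (a * d - b * c); nra.
Qed.

HB.instance Definition _ := @isMetric.Build R E2 euclidean_dist euclidean_distxx
  euclidean_dist_positivity euclidean_dist_sym euclidean_dist_triangle.

HB.instance Definition _ := isCoarse.Build E2
  (@metric_controlled_diag R E2) (@metric_controlled_sub R E2)
  (@metric_controlledU R E2) (@metric_controlledV R E2)
  (@metric_controlled_comp R E2).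

End euclidean_plane.

Section sub_coarse.
Context {X : coarseType} (A : set X).

Definition sub_controlled : set (set (A * A)) :=
  [set U | controlled (sq (val : A -> X) @` U)].

Lemma sub_controlled_diag : sub_controlled diagonal.
Proof.
apply: controlled_sub controlled_diag => _ [[x y]] /diagonalP -> <-.
exact/diagonalP.
Qed.

Lemma sub_controlled_sub U V : U `<=` V -> sub_controlled V -> sub_controlled U.
Proof. by move=> UV; apply: controlled_sub; exact: image_subset. Qed.

Lemma sub_controlledU U V : sub_controlled U -> sub_controlled V ->
  sub_controlled (U `|` V).
Proof. by rewrite /sub_controlled /= image_setU; exact: controlledU. Qed.

Lemma sub_controlledV U : sub_controlled U -> sub_controlled (U^-1)%relation.
Proof.
move=> /controlledV; apply: controlled_sub => _ [[x y] Uyx <-].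
by exists (y, x).
Qed.

Lemma sub_controlled_comp U V : sub_controlled U -> sub_controlled V ->
  sub_controlled (V \; U)%relation.
Proof.
move=> cU /(controlled_comp _ _ cU).
apply: controlled_sub => _ [[x y] [z Uxz Vzy] <-].
by exists (val z); [exists (x, z)|exists (z, y)].
Qed.

HB.instance Definition _ := isCoarse.Build (set_type A) sub_controlled_diag
  sub_controlled_sub sub_controlledU sub_controlledV sub_controlled_comp.

End sub_coarse.

Section prod_coarse.
Context {X Y : coarseType}.

Definition prod_controlled : set (set ((X * Y) * (X * Y))) :=
  [set E | controlled (sq fst @` E) /\ controlled (sq snd @` E)].

Lemma prod_controlled_diag : prod_controlled diagonal.
Proof.
by split; apply: controlled_sub controlled_diag => _ [[x y]] /diagonalP -> <-;
  exact/diagonalP.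
Qed.

Lemma prod_controlled_sub U V :
  U `<=` V -> prod_controlled V -> prod_controlled U.
Proof.
by move=> UV [c1 c2]; split; [apply: controlled_sub c1|apply: controlled_sub c2];
  exact: image_subset.
Qed.

Lemma prod_controlledU U V : prod_controlled U -> prod_controlled V ->
  prod_controlled (U `|` V).
Proof. by move=> [? ?] [? ?]; split; rewrite image_setU; exact: controlledU. Qed.

Lemma prod_controlledV U : prod_controlled U -> prod_controlled (U^-1)%relation.
Proof.
by move=> [/controlledV c1 /controlledV c2]; split;
  [apply: controlled_sub c1|apply: controlled_sub c2] => _ [[x y] Uyx <-];
  exists (y, x).
Qed.

Lemma prod_controlled_comp U V : prod_controlled U -> prod_controlled V ->
  prod_controlled (V \; U)%relation.
Proof.
move=> [u1 u2] [/(controlled_comp _ _ u1) c1 /(controlled_comp _ _ u2) c2].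
split; [apply: controlled_sub c1|apply: controlled_sub c2];
  move=> _ [[x y] [z Uxz Vzy] <-].
- by exists z.1; [exists (x, z)|exists (z, y)].
- by exists z.2; [exists (x, z)|exists (z, y)].
Qed.

HB.instance Definition _ := isCoarse.Build (X * Y)%type prod_controlled_diag
  prod_controlled_sub prod_controlledU prod_controlledV prod_controlled_comp.

End prod_coarse.

Definition halfline (R : realType) : Type := [set x : R | 0 <= x].
HB.instance Definition _ (R : realType) := Coarse.on (halfline R).

Section homotopy.
Context {R : realType} {X Y : coarseType}.

Definition cylinder (q : X -> halfline R) : set (X * halfline R) :=
  [set p | val p.2 <= val (q p.1)].

Lemma halfline0_subproof : [set x : R | 0 <= x] 0.
Proof. exact: lexx. Qed.

Definition halfline0 : halfline R := SigSub (mem_set halfline0_subproof).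

Lemma cylinder_bottom_subproof (q : X -> halfline R) x :
  cylinder q (x, halfline0).
Proof. exact: set_mem (valP (q x)). Qed.

Definition cylinder_bottom (q : X -> halfline R) (x : X) : cylinder q :=
  SigSub (mem_set (cylinder_bottom_subproof q x)).

Lemma cylinder_top_subproof (q : X -> halfline R) x : cylinder q (x, q x).
Proof. exact: lexx. Qed.

Definition cylinder_top (q : X -> halfline R) (x : X) : cylinder q :=
  SigSub (mem_set (cylinder_top_subproof q x)).

Definition coarse_homotopic (f g : X -> Y) : Prop :=
  exists (q : X -> halfline R) (H : cylinder q -> Y),
    [/\ coarse_map q, coarse_map H,
        forall x, H (cylinder_bottom q x) = f x
      & forall x, H (cylinder_top q x) = g x].

End homotopy.

Section paths.
Context {R : realType}.

Definition unit_cone : set (euclidean_plane R) :=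
  [set p | exists h t : R, [/\ 1 <= h, 0 <= t <= 1 & p = (h * t, h)]].

Lemma unit_cone_left_subproof (h : R) : 1 <= h -> unit_cone (0, h).
Proof. by move=> h1; exists h, 0; rewrite lexx ler01 mulr0. Qed.

Definition unit_cone_left (h : R) (h1 : 1 <= h) : unit_cone :=
  SigSub (mem_set (unit_cone_left_subproof h1)).

Lemma unit_cone_right_subproof (h : R) : 1 <= h -> unit_cone (h, h).
Proof. by move=> h1; exists h, 1; rewrite lexx ler01 mulr1. Qed.

Definition unit_cone_right (h : R) (h1 : 1 <= h) : unit_cone :=
  SigSub (mem_set (unit_cone_right_subproof h1)).

Definition is_coarse_1path (X : coarseType) (alpha alpha' : halfline R -> X)
    (phi : unit_cone -> X) : Prop :=
  [/\ coarse_map phi,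
      forall (h : halfline R) (h1 : 1 <= val h),
        phi (unit_cone_left h1) = alpha h
    & forall (h : halfline R) (h1 : 1 <= val h),
        phi (unit_cone_right h1) = alpha' h].

End paths.

Definition coarse_ray (R : realType) (X : coarseType) : Type :=
  [set alpha : halfline R -> X | coarse_map alpha].

Definition ray_val (R : realType) (X : coarseType) (alpha : coarse_ray R X) :
  halfline R -> X := val alpha.
Coercion ray_val : coarse_ray >-> Funclass.

Definition coarse_path_connected (R : realType) (X : coarseType)
    (alpha alpha' : coarse_ray R X) : Prop :=
  exists phi : unit_cone -> X, is_coarse_1path alpha alpha' phi.

Definition equiv_classes (T : Type) (r : T -> T -> Prop) : set (set T) :=
  range (fun x => [set y | r x y]).

Definition pi0_Crs (R : realType) (X : coarseType) : set (set (coarse_ray R X)) :=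
  equiv_classes (fun alpha beta : coarse_ray R X =>
    coarse_homotopic (R := R) alpha beta).
Arguments pi0_Crs R X : clear implicits.

(* Main.v *)
(* After reparametrization, a coarse 1-path and a coarse homotopy of rays are
   the same thing.  A path [phi] is a homotopy of height [max h 1], up to a
   modification at bounded distance over [0, 1].  Conversely, a controlled
   [q : [0, oo) -> [0, oo)] grows at most linearly, say [q h <= C h] for
   [h >= 1], so a homotopy [H] yields the path
   [(s, h) |-> H (h, min (C s) (q h))].  Paths are concatenated by running both
   at double speed; a pair of close points lying on different sides of the line
   [2 s = h] is controlled through the common ray on that line. *)
Require Import Defs.
From mathcomp Require Import lra.
Set Implicit Arguments.
Unset Strict Implicit.
Unset Printing Implicit Defensive.
Import Order.TTheory GRing.Theory Num.Theory.
Local Open Scope classical_set_scope.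
Local Open Scope ring_scope.

Arguments controlledU {s U V}.
Arguments controlledV {s U}.
Arguments controlled_comp {s U V}.

(** * Coarse maps: closeness, composition and gluing *)

Section coarse_generalities.
Context {X Y Z : coarseType}.

Definition close (f g : X -> Y) : Prop := controlled (range (fun x => (f x, g x))).

(** The pair [(g x, g y)] factors through [(g x, f x)], [(f x, f y)] and [(f y, g y)]. *)
Lemma controlled_map_close (f g : X -> Y) :
  close f g -> controlled_map f -> controlled_map g.
Proof.
move=> fg cf E /cf cE.
apply: controlled_sub (controlled_comp (controlled_comp (controlledV fg) cE) fg).
move=> _ [[x y] Exy <-] /=; exists (f y); last by exists y.
by exists (f x); [exists x | exists (x, y)].
Qed.

Lemma proper_map_close (f g : X -> Y) :
  close f g -> proper_map f -> proper_map g.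
Proof.
move=> fg pf B bB.
(* The preimage of [B] under [g] lies in the [f]-preimage of this set, whose pairs are controlled
   along [f x], [g x], [g y], [f y]. *)
have bB' : coarsely_bounded [set f x | x in g @^-1` B].
  apply: controlled_sub (controlled_comp (controlled_comp fg bB) (controlledV fg)).
  move=> [_ _] [/= [x Bx <-] [y By <-]]; exists (g y); last by exists y.
  by exists (g x); [exists x | split].
apply: controlled_sub (pf _ bB') => -[x y] [Bx By]; split; first by exists x.
by exists y.
Qed.

Lemma coarse_map_close (f g : X -> Y) : close f g -> coarse_map f -> coarse_map g.
Proof.
move=> fg [cf pf]; split; first exact: controlled_map_close fg cf.
exact: proper_map_close fg pf.
Qed.

Lemma controlled_map_comp (f : Y -> Z) (g : X -> Y) :
  controlled_map f -> controlled_map g -> controlled_map (f \o g).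
Proof.
move=> cf cg E /cg /cf; apply: controlled_sub => _ [p Ep <-].
by exists (sq g p) => //; exists p.
Qed.

Lemma coarse_map_comp (f : Y -> Z) (g : X -> Y) :
  coarse_map f -> coarse_map g -> coarse_map (f \o g).
Proof.
move=> [cf pf] [cg pg]; split; first exact: controlled_map_comp.
by move=> B /pf /pg.
Qed.

(** Each of [f] and [g] is frozen to [h] on the side where [k] does not follow it. For [x] in [A]
    and [y] outside, [k x = f x] is linked to [f y = h y], then to [h x = g x], then to [g y = k y];
    every link comes from the pair [(x, y)] or its inverse. *)
Lemma controlled_map_glue (A : set X) (f g h k : X -> Y) :
  controlled_map f -> controlled_map g -> controlled_map h ->
  (forall x, A x -> k x = f x /\ g x = h x) ->
  (forall x, ~ A x -> k x = g x /\ f x = h x) ->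
  controlled_map k.
Proof.
move=> cf cg ch kA knA E cE.
have [cfE cgE chE] := And3 (cf _ cE) (cg _ cE) (controlledV (ch _ cE)).
have cfhg := controlled_comp (controlled_comp cfE chE) cgE.
have cghf := controlled_comp (controlled_comp cgE chE) cfE.
apply: controlled_sub
  (controlledU (controlledU cfE cgE) (controlledU cfhg cghf)).
move=> _ [[x y] Exy <-]; rewrite /sq /=.
have [Ax|nAx] := pselect (A x); have [Ay|nAy] := pselect (A y).
- by left; left; exists (x, y) => //; rewrite /sq /= (kA _ Ax).1 (kA _ Ay).1.
- right; left; rewrite (kA _ Ax).1 (knA _ nAy).1.
  exists (h x); last by exists (x, y) => //; rewrite /sq /= (kA _ Ax).2.
  exists (h y); last by exists (x, y).
  by exists (x, y) => //; rewrite /sq /= (knA _ nAy).2.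
- right; right; rewrite (knA _ nAx).1 (kA _ Ay).1.
  exists (h x); last by exists (x, y) => //; rewrite /sq /= (knA _ nAx).2.
  exists (h y); last by exists (x, y).
  by exists (x, y) => //; rewrite /sq /= (kA _ Ay).2.
- by left; right; exists (x, y) => //; rewrite /sq /= (knA _ nAx).1 (knA _ nAy).1.
Qed.

End coarse_generalities.

(** * Corestriction and elementary estimates *)

Section codomain_restriction.
Context {S T : Type} (A : set T).

Definition corestrict (f : S -> T) (fA : forall x, A (f x)) (x : S) : A :=
  SigSub (mem_set (fA x)).

End codomain_restriction.

Section min_max_dist.
Context {R : realType}.
Implicit Types a b c d r : R.

Lemma ler_dist_min a b c d r :
  `|a - c| <= r -> `|b - d| <= r -> `|Num.min a b - Num.min c d| <= r.
Proof. by rewrite !ler_norml; case: (leP a b); case: (leP c d); lra. Qed.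

Lemma ler_dist_max a b c d r :
  `|a - c| <= r -> `|b - d| <= r -> `|Num.max a b - Num.max c d| <= r.
Proof. by rewrite !ler_norml; case: (leP a b); case: (leP c d); lra. Qed.

End min_max_dist.

(** * Controlled and bounded sets in coordinates; linear growth *)

Section metric_controlled_sets.
Context {R : realType}.

Lemma halfline_controlledP (U : set (halfline R * halfline R)) :
  controlled U <->
  exists r : R, forall x y, U (x, y) -> `|val x - val y| <= r.
Proof.
split=> [[r rU]|[r rU]]; exists r.
- move=> x y Uxy; rewrite distrC; apply: rU; exists (val x, val y) => //.
  by exists (x, y).
- move=> _ [_ [[x y] Uxy <-] <-] /=; have := rU _ _ Uxy.
  by rewrite distrC.
Qed.

Lemma ge_euclidean_dist (x y : euclidean_plane R) :
  `|x.1 - y.1| <= euclidean_dist x y /\ `|x.2 - y.2| <= euclidean_dist x y.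
Proof.
by rewrite /euclidean_dist -!sqrtr_sqr; split; apply: ler_wsqrtr;
  rewrite ?lerDl ?lerDr sqr_ge0.
Qed.

Lemma euclidean_dist_le (x y : euclidean_plane R) :
  euclidean_dist x y <= `|x.1 - y.1| + `|x.2 - y.2|.
Proof.
rewrite /euclidean_dist -[leRHS]ger0_norm ?addr_ge0// -sqrtr_sqr.
apply: ler_wsqrtr; rewrite [leRHS]sqrrD !real_normK ?num_real//.
by rewrite -addrA lerD2l lerDr mulrn_wge0 ?mulr_ge0.
Qed.

(** The Euclidean distance lies between the maximum and the sum of the coordinate distances, so
    control can be tested coordinatewise. *)
Lemma unit_cone_controlledP (U : set (@unit_cone R * @unit_cone R)) :
  controlled U <->
  exists r : R, forall x y, U (x, y) ->
    `|(val x).1 - (val y).1| <= r /\ `|(val x).2 - (val y).2| <= r.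
Proof.
split=> [[r rU]|[r rU]].
- exists r => x y Uxy.
  have xy_r : euclidean_dist (val x) (val y) <= r.
    by apply: rU; exists (val x, val y) => //; exists (x, y).
  have [xy1 xy2] := ge_euclidean_dist (val x) (val y).
  by split; [apply: le_trans xy1 _ | apply: le_trans xy2 _].
- exists (r + r) => _ [_ [[x y] Uxy <-] <-] /=.
  have [xy1 xy2] := rU _ _ Uxy.
  by apply: le_trans (euclidean_dist_le _ _) _; apply: lerD.
Qed.

Lemma cylinder_controlledP (q : halfline R -> halfline R)
    (U : set (cylinder q * cylinder q)) :
  controlled U <->
  exists r : R, forall x y, U (x, y) ->
    `|val (val x).1 - val (val y).1| <= r /\
    `|val (val x).2 - val (val y).2| <= r.
Proof.
split=> [[/halfline_controlledP[r rU] /halfline_controlledP[s sU]]|[r rU]].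
- exists (Num.max r s) => x y Uxy; rewrite !le_max; split; apply/orP.
  + by left; apply: rU; exists (val x, val y) => //; exists (x, y).
  + by right; apply: sU; exists (val x, val y) => //; exists (x, y).
- by split; apply/halfline_controlledP; exists r =>
    _ _ [_ [[x y] Uxy <-] [<- <-]]; have [] := rU _ _ Uxy.
Qed.

Lemma halfline_ge0 (x : halfline R) : 0 <= val x.
Proof. exact: set_mem (valP x). Qed.

Lemma unit_coneE (p : euclidean_plane R) :
  unit_cone p <-> 1 <= p.2 /\ 0 <= p.1 <= p.2.
Proof.
split=> [[h [t [h1 /andP[t0 t1] ->]]]|[]].
  by rewrite /= h1; split=> //; apply/andP; split; nra.
case: p => s h /= h1 /andP[s0 sh]; exists h, (s / h).
have h0 : 0 < h by apply: lt_le_trans h1.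
by rewrite mulrCA divff ?gt_eqF// mulr1 divr_ge0 ?(ltW h0)// ler_pdivrMr ?mul1r.
Qed.

Lemma unit_cone_bounds (p : @unit_cone R) :
  [/\ 1 <= (val p).2, 0 <= (val p).1 & (val p).1 <= (val p).2].
Proof. by have /unit_coneE[? /andP[]] := set_mem (valP p). Qed.

Lemma halfline_boundedP (B : set (halfline R)) :
  coarsely_bounded B <-> exists r : R, forall x, B x -> val x <= r.
Proof.
split=> [/halfline_controlledP[r rB]|[r rB]].
(* An upper bound is read off from one base point; the empty set has none, and there any bound will
   do. *)
- have [[y By]|nB] := pselect (exists y, B y); last first.
    by exists 0 => x Bx; case: nB; exists x.
  exists (val y + r) => x Bx.
  by have := rB x y (conj Bx By); rewrite ler_norml; lra.
- apply/halfline_controlledP; exists r => x y [/rB xr /rB yr].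
  by have := halfline_ge0 x; have := halfline_ge0 y; rewrite ler_norml; lra.
Qed.

(** Points [(s, h)] of the cone satisfy [0 <= s <= h], so the height controls both coordinates. *)
Lemma unit_cone_boundedP (B : set (@unit_cone R)) :
  coarsely_bounded B <-> exists r : R, forall x, B x -> (val x).2 <= r.
Proof.
split=> [/unit_cone_controlledP[r rB]|[r rB]].
- have [[y By]|nB] := pselect (exists y, B y); last first.
    by exists 0 => x Bx; case: nB; exists x.
  exists ((val y).2 + r) => x Bx.
  by have [_] := rB x y (conj Bx By); rewrite ler_norml; lra.
- apply/unit_cone_controlledP; exists r => x y [/rB xr /rB yr].
  have [x1 x0 xh] := unit_cone_bounds x; have [y1 y0 yh] := unit_cone_bounds y.
  by rewrite !ler_norml; lra.
Qed.

Lemma cylinder_boundedP (q : halfline R -> halfline R) (B : set (cylinder q)) :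
  coarsely_bounded B <->
  exists r : R, forall x, B x -> val (val x).1 <= r /\ val (val x).2 <= r.
Proof.
split=> [/cylinder_controlledP[r rB]|[r rB]].
- have [[y By]|nB] := pselect (exists y, B y); last first.
    by exists 0 => x Bx; case: nB; exists x.
  exists (val (val y).1 + val (val y).2 + r) => x Bx.
  have := halfline_ge0 (val y).1; have := halfline_ge0 (val y).2.
  by have [] := rB x y (conj Bx By); rewrite !ler_norml; lra.
- apply/cylinder_controlledP; exists r => x y [/rB xr /rB yr].
  have := halfline_ge0 (val x).1; have := halfline_ge0 (val x).2.
  have := halfline_ge0 (val y).1; have := halfline_ge0 (val y).2.
  by rewrite !ler_norml; lra.
Qed.

(** A point [x] is joined to 0 by about [x] steps of length at most 1, and control of [q] bounds its
    variation over all such steps by one constant [s]. *)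
Lemma halfline_map_linear_growth (q : halfline R -> halfline R) :
  controlled_map q ->
  exists2 C : R, 0 <= C & forall x, val (q x) <= C * (val x + 1).
Proof.
move=> cq.
have /cq/halfline_controlledP[s sq1] :
    controlled [set p : halfline R * halfline R | `|val p.1 - val p.2| <= 1].
  by apply/halfline_controlledP; exists 1.
have {}sq1 x y : `|val x - val y| <= 1 -> `|val (q x) - val (q y)| <= s.
  by move=> xy; apply: sq1; exists (x, y).
have s0 : 0 <= s.
  have := sq1 (@halfline0 R) (@halfline0 R).
  by rewrite !subrr normr0; apply; exact: ler01.
have linear n x : val x <= n%:R -> val (q x) <= val (q (@halfline0 R)) + s * n%:R.
  elim: n x => [|n IHn] x xn.
    have -> : x = @halfline0 R.
      by apply: val_inj; apply/eqP; rewrite eq_le xn halfline_ge0.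
    by rewrite mulr0 addr0.
  (* One step back towards 0, truncated so as to stay in the half-line. *)
  have y0 : [set t : R | 0 <= t] (Num.max 0 (val x - 1)) by rewrite /= le_max lexx.
  pose y : halfline R := SigSub (mem_set y0).
  have yn : val y <= n%:R.
    by rewrite /= ge_max ler0n lerBlDr natr1.
  have xy : `|val x - val y| <= 1.
    have -> : val y = Num.max 0 (val x - 1) by [].
    rewrite ler_norml; have := halfline_ge0 x; case: (leP 0 (val x - 1)); lra.
  have := IHn _ yn; have := sq1 _ _ xy.
  by rewrite ler_norml -natr1 mulrDr mulr1; lra.
have q0 := halfline_ge0 (q (@halfline0 R)).
(* With [n] the integer part of [x] plus one, [q 0 + s n <= q 0 + s (x + 1) <= (q 0 + s) (x +
   1)]. *)
exists (val (q (@halfline0 R)) + s) => [|x]; first by rewrite addr_ge0.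
have x0 := halfline_ge0 x.
have /andP[tx xt] := truncn_itv x0.
apply: le_trans (linear _ x (ltW xt)) _.
rewrite mulrDl -natr1; apply: lerD; first by rewrite ler_peMr// lerDr.
by rewrite ler_wpM2l// lerD2r.
Qed.

End metric_controlled_sets.

(** * Maps into and out of the cone *)

Section unit_cone_maps.
Context {R : realType}.

Lemma unit_cone_height_subproof (p : @unit_cone R) :
  [set h : R | 0 <= h] (val p).2.
Proof. by have [/= ? _ _] := unit_cone_bounds p; lra. Qed.

Definition unit_cone_height : @unit_cone R -> halfline R :=
  corestrict unit_cone_height_subproof.

Lemma unit_cone_height_ge1 p : 1 <= val (unit_cone_height p).
Proof. by case: (unit_cone_bounds p). Qed.

Lemma unit_cone_height_coarse : coarse_map unit_cone_height.
Proof.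
split=> [E /unit_cone_controlledP[r rE]|B /halfline_boundedP[r rB]].
- by apply/halfline_controlledP; exists r => _ _ [[x y] Exy [<- <-]];
    have [] := rE _ _ Exy.
- by apply/unit_cone_boundedP; exists r => x /rB.
Qed.

(* [A] is explicit since it would be inferred as a subset of [R * R], with the
   product coarse structure, instead of [euclidean_plane R]. *)
Lemma unit_cone_fiberwise_coarse (f : @unit_cone R -> R)
    (fA : forall p, unit_cone (f p, (val p).2)) :
  (forall r p p', `|(val p).1 - (val p').1| <= r ->
    `|(val p).2 - (val p').2| <= r -> `|f p - f p'| <= 3 * r) ->
  coarse_map (corestrict (A := @unit_cone R) fA).
Proof.
move=> f_lip; split=> [E /unit_cone_controlledP[r rE]|B /unit_cone_boundedP[r rB]].
- apply/unit_cone_controlledP; exists (3 * r) => _ _ [[x y] Exy [<- <-]] /=.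
  have [xy1 xy2] := rE _ _ Exy; split; first exact: f_lip.
  by have := normr_ge0 ((val x).2 - (val y).2); lra.
- by apply/unit_cone_boundedP; exists r => x /rB.
Qed.

Lemma unit_cone_leftP (p : @unit_cone R) :
  (val p).1 = 0 -> p = unit_cone_left (unit_cone_height_ge1 p).
Proof. by case: p => [[s h] ps] /= s0; apply: val_inj; rewrite /= s0. Qed.

Lemma unit_cone_rightP (p : @unit_cone R) :
  (val p).1 = (val p).2 -> p = unit_cone_right (unit_cone_height_ge1 p).
Proof. by case: p => [[s h] ps] /= sh; apply: val_inj; rewrite /= sh. Qed.

End unit_cone_maps.

(** * Coarse paths as an equivalence relation *)

Section paths_equivalence.
Context {R : realType} {X : coarseType}.
Implicit Types alpha beta gamma : coarse_ray R X.

Lemma coarse_ray_coarse alpha : coarse_map alpha.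
Proof. exact: set_mem (valP alpha). Qed.

(** Moves the endpoint conditions to equations between coordinates, so that no proof of [1 <= h] has
    to be carried along. *)
Lemma is_coarse_1pathP alpha beta (phi : unit_cone -> X) :
  coarse_map phi ->
  (forall p, (val p).1 = 0 -> phi p = alpha (unit_cone_height p)) ->
  (forall p, (val p).1 = (val p).2 -> phi p = beta (unit_cone_height p)) ->
  is_coarse_1path alpha beta phi.
Proof.
move=> cphi phi0 phi1; split=> // h h1.
- by rewrite phi0//; congr (alpha _); exact: val_inj.
- by rewrite phi1//; congr (beta _); exact: val_inj.
Qed.

Lemma coarse_1path_left alpha beta phi (p : @unit_cone R) :
  is_coarse_1path alpha beta phi ->
  (val p).1 = 0 -> phi p = alpha (unit_cone_height p).
Proof. by move=> [_ phi0 _] /unit_cone_leftP{1}->; rewrite phi0. Qed.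

Lemma coarse_1path_right alpha beta phi (p : @unit_cone R) :
  is_coarse_1path alpha beta phi ->
  (val p).1 = (val p).2 -> phi p = beta (unit_cone_height p).
Proof. by move=> [_ _ phi1] /unit_cone_rightP{1}->; rewrite phi1. Qed.

Lemma coarse_path_connected_refl alpha : coarse_path_connected alpha alpha.
Proof.
exists (alpha \o unit_cone_height); apply: is_coarse_1pathP => //.
by apply: coarse_map_comp (coarse_ray_coarse _) unit_cone_height_coarse.
Qed.

Lemma coarse_path_connected_sym alpha beta :
  coarse_path_connected alpha beta -> coarse_path_connected beta alpha.
Proof.
move=> [phi phiP].
have flipA (p : @unit_cone R) : unit_cone ((val p).2 - (val p).1, (val p).2).
  have [p1 p0 ph] := unit_cone_bounds p.
  by apply/unit_coneE => /=; split=> //; apply/andP; split; lra.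
pose flip := corestrict (A := @unit_cone R) flipA.
exists (phi \o flip); apply: is_coarse_1pathP.
- apply: coarse_map_comp; first by case: phiP.
  apply: unit_cone_fiberwise_coarse => r p p'.
  by rewrite !ler_norml; lra.
- move=> p p0; rewrite /= (coarse_1path_right phiP) /=; last by lra.
  by congr (beta _); exact: val_inj.
- move=> p ph; rewrite /= (coarse_1path_left phiP) /=; last by lra.
  by congr (alpha _); exact: val_inj.
Qed.

Lemma coarse_path_connected_trans alpha beta gamma :
  coarse_path_connected alpha beta -> coarse_path_connected beta gamma ->
  coarse_path_connected alpha gamma.
Proof.
move=> [phi phiP] [psi psiP].
(* Clamping makes both halves total: beyond [2 s = h] the first stays on the right edge, and before
   it the second stays on the left edge. Both paths are then equal to [beta] there, as gluing
   requires. *)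
have firstA (p : @unit_cone R) :
    unit_cone (Num.min (2 * (val p).1) (val p).2, (val p).2).
  have [p1 p0 ph] := unit_cone_bounds p.
  by apply/unit_coneE => /=; split=> //; apply/andP; split;
    case: (leP (2 * (val p).1) (val p).2); lra.
have secondA (p : @unit_cone R) :
    unit_cone (Num.max (2 * (val p).1 - (val p).2) 0, (val p).2).
  have [p1 p0 ph] := unit_cone_bounds p.
  by apply/unit_coneE => /=; split=> //; apply/andP; split;
    case: (leP (2 * (val p).1 - (val p).2) 0); lra.
pose first_half := corestrict (A := @unit_cone R) firstA.
pose second_half := corestrict (A := @unit_cone R) secondA.
have [cphi pphi] : coarse_map (phi \o first_half).
  apply: coarse_map_comp; first by case: phiP.
  apply: unit_cone_fiberwise_coarse => r p p' pp1 pp2; apply: ler_dist_min.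
    by move: pp1 pp2; rewrite !ler_norml; lra.
  by have := normr_ge0 ((val p).2 - (val p').2); lra.
have [cpsi ppsi] : coarse_map (psi \o second_half).
  apply: coarse_map_comp; first by case: psiP.
  (* If [s] and [h] vary by at most [r], then [2 s - h] varies by at most [3 r]. *)
  apply: unit_cone_fiberwise_coarse => r p p' pp1 pp2; apply: ler_dist_max.
    by move: pp1 pp2; rewrite !ler_norml; lra.
  by have := normr_ge0 ((val p).2 - (val p').2); rewrite subrr normr0; lra.
have [cbeta _] := coarse_map_comp (coarse_ray_coarse beta) unit_cone_height_coarse.
have phi_right (p : @unit_cone R) : (val p).2 <= 2 * (val p).1 ->
    phi (first_half p) = beta (unit_cone_height p).
  move=> hp; rewrite (coarse_1path_right phiP) /=; last exact/min_idPr.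
  by congr (beta _); exact: val_inj.
have psi_left (p : @unit_cone R) : 2 * (val p).1 <= (val p).2 ->
    psi (second_half p) = beta (unit_cone_height p).
  move=> hp; rewrite (coarse_1path_left psiP) /=; last first.
    by apply/max_idPr; lra.
  by congr (beta _); exact: val_inj.
exists (fun p => if 2 * (val p).1 <= (val p).2 then phi (first_half p)
                 else psi (second_half p)).
apply: is_coarse_1pathP; first split.
- apply: (controlled_map_glue
    (A := [set p : @unit_cone R | 2 * (val p).1 <= (val p).2]) cphi cpsi cbeta).
  + by move=> p /= hp; rewrite hp psi_left.
  + move=> p /= /negP hp; rewrite (negbTE hp) phi_right//.
    by rewrite -ltNge in hp; exact: ltW.
(* The preimage of [B] is covered by its preimages under the two halves, both of bounded height. *)
- move=> B bB.
  have /unit_cone_boundedP[r rB] := pphi _ bB.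
  have /unit_cone_boundedP[s sB] := ppsi _ bB.
  apply/unit_cone_boundedP; exists (Num.max r s) => p /=.
  by rewrite le_max; case: ifP => _ => [/rB ->|/sB ->]; rewrite ?orbT.
- move=> p p0; have [p1 _ _] := unit_cone_bounds p; rewrite p0 mulr0.
  rewrite (le_trans ler01 p1) (coarse_1path_left phiP) /=; last first.
    by rewrite p0 mulr0; apply/min_idPl; lra.
  by congr (alpha _); exact: val_inj.
(* On the right edge the test reads [2 h <= h], which fails because [h >= 1]. *)
- move=> p ph; have [p1 _ _] := unit_cone_bounds p; rewrite ifF; last first.
    by apply/negbTE; rewrite -ltNge; lra.
  rewrite (coarse_1path_right psiP) /=; last first.
    have phE : 2 * (val p).1 - (val p).2 = (val p).2 by lra.
    by apply: (etrans (max_l _) phE); rewrite phE; lra.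
  by congr (gamma _); exact: val_inj.
Qed.


(** * Comparison of coarse paths with coarse homotopies *)

Lemma coarse_path_connected_homotopic alpha beta :
  coarse_path_connected alpha beta -> coarse_homotopic (R := R) alpha beta.
Proof.
move=> [phi phiP].
have max1_ge1 (x : halfline R) : 1 <= Num.max (val x) 1 by rewrite le_max lexx orbT.
have max1_ge0 (x : halfline R) : [set t : R | 0 <= t] (Num.max (val x) 1).
  exact: le_trans ler01 (max1_ge1 x).
pose q : halfline R -> halfline R := corestrict max1_ge0.
have coneA (z : cylinder q) :
    unit_cone ((val (val z).2, Num.max (val (val z).1) 1) : euclidean_plane R).
  apply/unit_coneE; rewrite halfline_ge0; split; first exact: max1_ge1.
  exact: set_mem (valP z).
pose toCone : cylinder q -> @unit_cone R := corestrict (A := @unit_cone R) coneA.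
have cq : coarse_map q.
  split=> [E /halfline_controlledP[r rE]|B /halfline_boundedP[r rB]].
  - apply/halfline_controlledP; exists r => _ _ [[x y] Exy [<- <-]] /=.
    have xy := rE _ _ Exy.
    by apply: ler_dist_max => //; rewrite subrr normr0 (le_trans _ xy).
  - apply/halfline_boundedP; exists r => x /rB; apply: le_trans.
    by rewrite /= le_max lexx.
have ctoCone : coarse_map toCone.
  split=> [E /cylinder_controlledP[r rE]|B /unit_cone_boundedP[r rB]].
  - apply/unit_cone_controlledP; exists r => _ _ [[x y] Exy [<- <-]] /=.
    have [xy1 ?] := rE _ _ Exy; split=> //.
    by apply: ler_dist_max => //; rewrite subrr normr0 (le_trans _ xy1).
  (* The height [max x 1] of the image of [(x, t)] dominates both [x] and [t]. *)
  - apply/cylinder_boundedP; exists r => z /rB /= zr.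
    have [_ _ /= z2] := unit_cone_bounds (toCone z).
    by split; [rewrite (le_trans _ zr)// le_max lexx | exact: le_trans zr].
(* [q] moves each point by at most 1, and [gamma] is controlled. *)
have ray_close (gamma : coarse_ray R X) : close (gamma \o q) gamma.
  have [cgamma _] := coarse_ray_coarse gamma.
  apply: controlled_sub (cgamma (range (fun x => (q x, x))) _).
    by move=> _ [x _ <-]; exists (q x, x) => //; exists x.
  apply/halfline_controlledP; exists 1 => _ _ [x _ [<- <-]].
  have -> : val (q x) = Num.max (val x) 1 by [].
  by have := halfline_ge0 x; rewrite ler_norml; case: (leP (val x) 1); lra.
(* On the two ends [phi \o toCone] takes the values [alpha (q x)] and [beta (q x)]; they are
   replaced by the required [alpha x] and [beta x]. *)
pose H (z : cylinder q) : X :=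
  if val (val z).2 == 0 then alpha (val z).1
  else if val (val z).2 == val (q (val z).1) then beta (val z).1
  else phi (toCone z).
exists q, H; split=> //.
- apply: (@coarse_map_close _ _ (phi \o toCone)); last first.
    by apply: coarse_map_comp => //; case: phiP.
  apply: controlled_sub (controlledU (controlledU (ray_close alpha)
    (ray_close beta)) controlled_diag).
  move=> _ [z _ <-]; rewrite /H /=; case: eqP => [z0|_].
    left; left; exists (val z).1 => //; rewrite (coarse_1path_left phiP)//.
    by congr (alpha _, _); exact: val_inj.
  case: eqP => [z1|_]; last by right; apply/diagonalP.
  left; right; exists (val z).1 => //; rewrite (coarse_1path_right phiP)//.
  by congr (beta _, _); exact: val_inj.
- by move=> x; rewrite /H /= eqxx.
(* As [q x >= 1], the top never meets the bottom, so the first test of [H] fails here. *)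
- move=> x; rewrite /H /= eqxx gt_eqF//.
  exact: lt_le_trans ltr01 (max1_ge1 x).
Qed.

Lemma homotopic_coarse_path_connected alpha beta :
  coarse_homotopic (R := R) alpha beta -> coarse_path_connected alpha beta.
Proof.
move=> [q [H [[cq _] cH H0 H1]]].
have [C C0 qC] := halfline_map_linear_growth cq.
pose qh (p : @unit_cone R) : R := val (q (unit_cone_height p)).
(* Since [h >= 1], [q h <= C (h + 1) <= 2 C h]: slope [2 C] reaches the top of the cylinder by
   [s = h]. *)
have level0 (p : @unit_cone R) :
    [set t : R | 0 <= t] (Num.min (2 * C * (val p).1) (qh p)).
  have [_ p0 _] := unit_cone_bounds p.
  by rewrite /= le_min halfline_ge0 !mulr_ge0.
pose level : @unit_cone R -> halfline R := corestrict level0.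
have cylA (p : @unit_cone R) : cylinder q (unit_cone_height p, level p).
  by rewrite /cylinder /= ge_min lexx orbT.
have ccyl : coarse_map (corestrict (A := cylinder q) cylA).
  (* Properness follows from the first coordinate, which is the height in the cone. *)
  split=> [E cE|B /cylinder_boundedP[r rB]]; last first.
    by apply/unit_cone_boundedP; exists r => x /rB [].
  have /halfline_controlledP[s sE] := cq _ (unit_cone_height_coarse.1 _ cE).
  have /unit_cone_controlledP[r rE] := cE.
  (* One bound for three variations: [r] for the height, [2 C r] for the slope term, [s] for [q]. *)
  apply/cylinder_controlledP; exists (2 * C * r + r + s)
    => _ _ [[x y] Exy [<- <-]] /=.
  have [xy1 xy2] := rE _ _ Exy.
  have qxy : `|qh x - qh y| <= s.
    by apply: sE; exists (unit_cone_height x, unit_cone_height y) => //; exists (x, y).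
  have Cr0 : 0 <= C * r by rewrite mulr_ge0// (le_trans _ xy1).
  have r0 : 0 <= r by rewrite (le_trans _ xy1).
  have s0 : 0 <= s by rewrite (le_trans _ qxy).
  split; first by lra.
  apply: ler_dist_min; last by lra.
  rewrite -!mulrA -!mulrBr !normrM (ger0_norm C0) ger0_norm//.
  have : C * `|(val x).1 - (val y).1| <= C * r by rewrite ler_wpM2l.
  lra.
exists (H \o corestrict (A := cylinder q) cylA); apply: is_coarse_1pathP.
- exact: coarse_map_comp.
- move=> p p0; rewrite -H0 /=; congr (H _); apply: val_inj.
  congr (_, _); apply: val_inj; rewrite /= p0 mulr0; apply/min_idPl.
  exact: halfline_ge0.
- move=> p ph; rewrite -H1 /=; congr (H _); apply: val_inj.
  congr (_, _); apply: val_inj; rewrite /= ph; apply/min_idPr.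
  apply: le_trans (qC _) _; rewrite -mulrA mulrCA ler_wpM2l//=.
  by have [p1 _ _] := unit_cone_bounds p; lra.
Qed.

End paths_equivalence.

Theorem proposition6p14 (R : realType) (X : coarseType) :
  Equivalence (@coarse_path_connected R X) /\
  equiv_classes (@coarse_path_connected R X) = pi0_Crs R X.
Proof.
split.
  split; first exact: coarse_path_connected_refl.
    exact: coarse_path_connected_sym.
  exact: coarse_path_connected_trans.
(* Both sets of classes arise by [equiv_classes], so it suffices that the two relations are
   equal. *)
congr equiv_classes; apply/funext => alpha; apply/funext => beta; apply/propext.
split; first exact: coarse_path_connected_homotopic.
exact: homotopic_coarse_path_connected.
Qed.
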